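(* Let $p,q,n$ be positive integers with $n\ge 2$, let $\mu\in\mathbb{R}^{pq}$, and let $\Gamma\in\mathcal{M}_{p,p}(\mathbb{R})$ and $\Psi\in\mathcal{M}_{q,q}(\mathbb{R})$ be diagonal matrices with strictly positive diagonal entries ($\mu,\Gamma,\Psi$ unknown). Let $X_1,\ldots,X_n$ be independent random matrices in $\mathcal{M}_{p,q}(\mathbb{R})$ with $\mathrm{vec}(X_k)\sim\mathcal{N}(\mu,\Psi\otimes\Gamma)$ for $k=1,\ldots,n$. Then with probability $1$ there exists a unique maximum likelihood estimator of the covariance matrix $\Psi\otimes\Gamma$ (in the model in which both $\Gamma$ and $\Psi$ are constrained to be diagonal).
   Context: $\mathcal{M}_{p,q}(\mathbb{R})$ is the set of real $p\times q$ matrices, $\mathrm{vec}$ stacks the columns of a matrix into one vector, and $\otimes$ is the Kronecker product. The likelihood function, for $M\in\mathcal{M}_{p,q}(\mathbb{R})$ (with $\mathrm{vec}(M)$ the mean vector) and positive definite $\Gamma\in\mathcal{M}_{p,p}(\mathbb{R})$, $\Psi\in\mathcal{M}_{q,q}(\mathbb{R})$, is $$L(M,\Gamma,\Psi)=(2\pi)^{-\frac12 pqn}|\Gamma|^{-\frac12 qn}|\Psi|^{-\frac12 pn}\exp\Big(-\tfrac12\,\mathrm{trace}\Big(\Psi^{-1}\sum_{k=1}^n (X_k-M)^T\Gamma^{-1}(X_k-M)\Big)\Big),$$ where $|A|$ is the determinant of $A$. It depends on $(\Gamma,\Psi)$ only through $\Psi\otimes\Gamma$. In the diagonal model, a maximum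 likelihood estimator of $\Psi\otimes\Gamma$ is a matrix $\hat\Psi\otimes\hat\Gamma$, with $\hat\Gamma,\hat\Psi$ diagonal with strictly positive diagonal entries, such that $L$ attains its maximum over all $M\in\mathcal{M}_{p,q}(\mathbb{R})$ and all diagonal $\Gamma,\Psi$ with strictly positive diagonal entries at $(\hat M,\hat\Gamma,\hat\Psi)$, where $\hat M=\frac1n\sum_{k=1}^n X_k$. It is unique if there is exactly one such matrix $\hat\Psi\otimes\hat\Gamma$ (uniqueness concerns the Kronecker product, not the two factors separately). *)

(* Defs.v *)
From HB Require Import structures.
From mathcomp Require Import all_boot all_order all_algebra.
From mathcomp Require Import all_classical all_reals all_analysis.
From mathcomp Require Import mxtens.

Set Implicit Arguments.
Unset Strict Implicit.
Unset Printing Implicit Defensive.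

Import Order.TTheory GRing.Theory Num.Theory.
Import numFieldNormedType.Exports.

Local Open Scope classical_set_scope.
Local Open Scope ring_scope.

(* The Kronecker product A (x) B is [tensmx A B]: the index (i, k) of
   'I_m * 'I_n is encoded as i * n + k. *)

(* Column stacking: entry (i, j) of A goes to position j * p + i, that is, to
   the index of (j, i) in [tensmx Psi Gamma] for Psi of size q and Gamma of
   size p.  ([mxvec] would stack the rows.) *)
Definition vec (R : realType) (p q : nat) (A : 'M[R]_(p, q)) : 'cV[R]_(q * p) :=
  \col_k A (mxtens_unindex k).2 (mxtens_unindex k).1.

Lemma vecE (R : realType) (p q : nat) (A : 'M[R]_(p, q)) (i : 'I_p) (j : 'I_q) :
  vec A (mxtens_index (j, i)) 0 = A i j.
Proof. by rewrite mxE mxtens_indexK. Qed.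

(* Matrices with their Borel sigma-algebra. *)
Notation borel_mx R p q := (g_sigma_algebraType (@open 'M[R]_(p, q))).

Definition independent_RVs d d' (T : measurableType d) (T' : measurableType d')
    (R : realType) (P : probability T R) (n : nat)
    (X : 'I_n -> {RV P >-> T'}) : Prop :=
  forall (J : {set 'I_n}) (B : 'I_n -> set T'),
    (forall k, measurable (B k)) ->
    P (\bigcap_(k in [set` J]) (X k @^-1` B k)) =
    (\prod_(k in J) P (X k @^-1` B k))%E.

(* N(m, v), parametrized by the variance v, with the Dirac measure for v = 0;
   [normal_prob] takes the standard deviation and is not degenerate at 0. *)
Definition gaussian (R : realType) (m v : R) (B : set R) : \bar R :=
  if v == 0 then \d_m B else normal_prob m (Num.sqrt v) B.

(* Y ~ N(mu, Sigma), Sigma positive semidefinite: every linear combination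
   a^T Y has the law N(a^T mu, a^T Sigma a). *)
Definition multivariate_normal d (T : measurableType d) (R : realType)
    (P : probability T R) (m : nat) (Y : T -> 'cV[R]_m)
    (mu : 'cV[R]_m) (Sigma : 'M[R]_m) : Prop :=
  forall (a : 'cV[R]_m) (B : set R), measurable B ->
    P ((fun w => (a^T *m Y w) 0 0) @^-1` B) =
    gaussian ((a^T *m mu) 0 0) ((a^T *m Sigma *m a) 0 0) B.

Definition pos_diag (R : realType) (m : nat) (A : 'M[R]_m) : Prop :=
  is_diag_mx A /\ forall i, 0 < A i i.

Section Likelihood.
Variables (R : realType) (p q n : nat) (X : 'I_n -> 'M[R]_(p, q)).

Definition likelihood (M : 'M[R]_(p, q)) (Gamma : 'M[R]_p) (Psi : 'M[R]_q) : R :=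
  (2 * pi) `^ (- (p * q * n)%:R / 2) *
  \det Gamma `^ (- (q * n)%:R / 2) *
  \det Psi `^ (- (p * n)%:R / 2) *
  expR (- 2^-1 * \tr (invmx Psi *m
          (\sum_(k < n) (X k - M)^T *m invmx Gamma *m (X k - M)))).

Definition sample_mean : 'M[R]_(p, q) := n%:R^-1 *: \sum_(k < n) X k.

(* K is a maximum likelihood estimator of Psi (x) Gamma in the model in which
   both factors are diagonal. *)
Definition is_diag_MLE (K : 'M[R]_(q * p)) : Prop :=
  exists (Gamma' : 'M[R]_p) (Psi' : 'M[R]_q),
    [/\ pos_diag Gamma', pos_diag Psi', K = tensmx Psi' Gamma' &
        forall (M : 'M[R]_(p, q)) (Gamma : 'M[R]_p) (Psi : 'M[R]_q),
          pos_diag Gamma -> pos_diag Psi ->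
          likelihood M Gamma Psi <= likelihood sample_mean Gamma' Psi'].

End Likelihood.

(* Main.v *)
(* With u_i = - ln Gamma_ii and v_j = - ln Psi_jj, the log-likelihood at the
   sample mean is, up to a constant, half of
     sum_ij (n (u_i + v_j) - S_ij exp (u_i + v_j)),
   where S_ij is the sum of the squared deviations of the (i, j) entries; any
   other mean only increases S_ij.  If all S_ij > 0, each term is a strictly
   concave and coercive function of t_ij = u_i + v_j.  So a maximum exists and
   determines the t_ij, that is, the diagonal entries exp (- t_ij) of
   Psi (x) Gamma.  Finally S_ij > 0 almost surely, since the (i, j) entries of
   X_1 and X_2 are independent and have a law without atoms, hence are almost
   surely distinct. *)
Require Import Defs.
From HB Require Import structures.
From mathcomp Require Import all_boot all_order all_algebra.
From mathcomp Require Import all_classical all_reals all_analysis.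
From mathcomp Require Import measurable_realfun mxtens ring lra.
Import Order.TTheory GRing.Theory Num.Theory.
Import numFieldNormedType.Exports.
Local Open Scope classical_set_scope.
Local Open Scope ring_scope.

Set Implicit Arguments.
Unset Strict Implicit.

(** * Almost sure distinctness of corresponding entries of two samples *)

Lemma measurable_mx_entry (R : realType) (p q : nat) (i : 'I_p) (j : 'I_q) :
  measurable_fun [set: borel_mx R p q] (fun M : borel_mx R p q => M i j : R).
Proof.
apply: (measurability _ (RGenOpens.measurableE R)) => _ [_ [x [y ->]] <-].
rewrite setTI; apply: sub_sigma_algebra.
apply: (open_comp (f := fun M : 'M[R]_(p, q) => M i j)).
  by move=> M _; exact: coord_continuous.
exact: itv_open.
Qed.

Lemma measurable_diagonal (R : realType) :
  measurable [set z : R * R | z.1 = z.2].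
Proof.
have := @measurable_fun_eqr _ (R * R)%type R setT fst snd
  (@measurable_fst _ _ R R) (@measurable_snd _ _ R R).
move=> /(_ measurableT [set true] I); rewrite setTI.
by congr measurable; apply/seteqP; split => z /= /eqP.
Qed.

(** By independence the joint law of [(Y, Z)] is the product of the marginal laws. By Fubini the
    diagonal then has measure the integral of [P (Z = x)] over the law of [Y], which is zero. *)
Lemma independent_atomless_ae_neq (d : measure_display) (T : measurableType d)
    (R : realType) (P : probability T R) (Y Z : {mfun T >-> R}) :
  (forall A B, measurable A -> measurable B ->
     P (Y @^-1` A `&` Z @^-1` B) = (P (Y @^-1` A) * P (Z @^-1` B))%E) ->
  (forall x, P (Z @^-1` [set x]) = 0%E) ->
  {ae P, forall w, Y w != Z w}.
Proof.
move=> indep natom.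
have mYZ : measurable_fun setT (fun w => (Y w, Z w)).
  exact: measurable_fun_pair.
pose YZ : {mfun T >-> (R * R)%type} := mfun_Sub (mem_set mYZ).
have PYZ A : measurable A ->
    (distribution P Y \x distribution P Z)%E A = distribution P YZ A.
  by move=> mA; apply: product_measure_unique => // B C mB mC; exact: indep.
exists (YZ @^-1` [set z : R * R | z.1 = z.2]); split.
- rewrite -[X in measurable X]setTI.
  exact: (mYZ measurableT _ (@measurable_diagonal R)).
- rewrite -[LHS]/(distribution P YZ _) -PYZ; last exact: measurable_diagonal.
  rewrite /product_measure1; apply: integral0_eq => x _ /=.
  rewrite -[RHS](natom x) /distribution /pushforward; congr (P _).
  by apply/seteqP; split => w /=; rewrite /xsection/= inE/=.
- by move=> w /= /negP; rewrite negbK => /eqP.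
Qed.

Lemma gaussian_set1 (R : realType) (m v x : R) :
  0 < v -> gaussian m v [set x] = 0%E.
Proof.
move=> v0; rewrite /gaussian gt_eqF//.
have /null_content_dominatesP := @normal_prob_dominates R m (Num.sqrt v).
by apply => //; exact: lebesgue_measure_set1.
Qed.

(** Presents a matrix entry as a linear combination of [vec M], the form to which
    [multivariate_normal] applies. *)
Lemma vec_delta (R : realType) (p q : nat) (i : 'I_p) (j : 'I_q)
    (M : 'M[R]_(p, q)) :
  ((delta_mx (mxtens_index (j, i)) 0 : 'cV[R]_(q * p))^T *m vec M) 0 0 = M i j.
Proof. by rewrite trmx_delta -rowE mxE vecE. Qed.

Lemma normal_entries_ae_neq (R : realType) (d : measure_display)
    (T : measurableType d) (P : probability T R) (p q n : nat)
    (mu : 'cV[R]_(q * p)) (Gamma : 'M[R]_p) (Psi : 'M[R]_q)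
    (X : 'I_n -> {RV P >-> borel_mx R p q}) (k l : 'I_n) (i : 'I_p) (j : 'I_q) :
  pos_diag Gamma -> pos_diag Psi -> independent_RVs X ->
  multivariate_normal P (fun w => vec (X l w)) mu (tensmx Psi Gamma) ->
  k != l -> {ae P, forall w, X k w i j != X l w i j}.
Proof.
move=> [_ Gamma0] [_ Psi0] indep normal kl.
have mentry m : measurable_fun setT (fun w => X m w i j : R).
  exact: (measurableT_comp (measurable_mx_entry i j) (measurable_funPT (X m))).
pose Y m : {mfun T >-> R} := mfun_Sub (mem_set (mentry m)).
apply: (@independent_atomless_ae_neq _ T R P (Y k) (Y l)).
- move=> A B mA mB.
  (* Independence concerns Borel sets of matrices, so [A] and [B] are pulled back along the entry
     map; only the indices [k] and [l] enter the intersection. *)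
  pose C m := [set M : borel_mx R p q | (if m == k then A else B) (M i j)].
  have mC m : measurable (C m).
    rewrite -[C m]setTI; apply: (measurable_mx_entry i j) => //.
    by case: ifP.
  have := indep [set k; l]%SET C mC.
  rewrite big_setU1 ?inE//= big_set1 /C eqxx eq_sym (negbTE kl) => <-.
  congr (P _); apply/seteqP; split => w /=.
    move=> [Aw Bw] m /=; rewrite !inE.
    by case/orP => /eqP -> /=; rewrite ?eqxx// eq_sym (negbTE kl).
  move=> H; split.
    by have := H k; rewrite /= !inE eqxx; exact.
  by have := H l; rewrite /= !inE eqxx orbT eq_sym (negbTE kl); exact.
- move=> x.
  (* Along this unit vector the variance is [Psi j j * Gamma i i], which is positive, so the law has
     no atoms. *)
  pose a : 'cV[R]_(q * p) := delta_mx (mxtens_index (j, i)) 0.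
  rewrite (_ : Y l @^-1` [set x] =
    (fun w => (a^T *m vec (X l w)) 0 0) @^-1` [set x]).
    rewrite normal//; apply: gaussian_set1.
    by rewrite trmx_delta -rowE -colE !mxE !mxtens_indexK mulr_gt0.
  by apply/seteqP; split => w /=; rewrite vec_delta.
Qed.

(** * Maximization of the profile function *)

Lemma expR_half (R : realType) (t : R) : expR t = expR (t / 2) ^+ 2.
Proof. by rewrite -expRM_natl; congr expR; field. Qed.

Section Profile.
Variables (R : realType) (p q n : nat) (S : 'I_p -> 'I_q -> R).
Hypotheses (n_gt0 : (0 < n)%N) (S_gt0 : forall i j, 0 < S i j).
Implicit Types (u : 'I_p -> R) (v : 'I_q -> R).

Definition profile u v : R :=
  \sum_i \sum_j (n%:R * (u i + v j) - S i j * expR (u i + v j)).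

(** Coercivity of one term, with linear decay in [|t|]. For [t < 0] it follows from [n >= 1]; for
    [t >= 0] from [expR t >= t ^+ 2 / 4] and completing the square. *)
Lemma profile_term_ub (s t : R) :
  0 < s -> n%:R * t - s * expR t <= (n%:R + 1) ^+ 2 / s - `|t|.
Proof.
move=> s0.
have n1 : (1 : R) <= n%:R by rewrite ler1n.
have [t0|t0] := leP 0 t; last first.
  have se0 : 0 < s * expR t by rewrite mulr_gt0 ?expR_gt0.
  rewrite ltr0_norm//.
  have : 0 <= (n%:R + 1) ^+ 2 / s by rewrite divr_ge0 ?sqr_ge0 ?ltW.
  by move: (_ / s) => A A0; nra.
have ht : t ^+ 2 / 4 <= expR t.
  rewrite expR_half; have := expR_ge1Dx (t / 2) => h; nra.
rewrite ger0_norm//.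
have hs : s * (t ^+ 2 / 4) <= s * expR t by rewrite ler_pM2l.
rewrite -subr_ge0.
apply: (@le_trans _ _ (s / 4 * (t - 2 * (n%:R + 1) / s) ^+ 2)).
  by rewrite mulr_ge0 ?sqr_ge0// divr_ge0// ltW.
rewrite -subr_ge0.
rewrite (_ : _ - _ = s * expR t - s * (t ^+ 2 / 4)) ?subr_ge0//.
by field; rewrite gt_eqF.
Qed.

Lemma profile_ub u v :
  profile u v <= \sum_i \sum_j (n%:R + 1) ^+ 2 / S i j
                 - \sum_i \sum_j `|u i + v j|.
Proof.
rewrite -sumrB; apply: ler_sum => i _; rewrite -sumrB.
by apply: ler_sum => j _; exact: profile_term_ub.
Qed.

Lemma profile_shift u v (c : R) :
  profile (fun i => u i + c) (fun j => v j - c) = profile u v.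
Proof.
by apply: eq_bigr => i _; apply: eq_bigr => j _; rewrite addrACA subrr addr0.
Qed.

Lemma continuous_profile :
  continuous (fun x : 'rV[R]_(p + q) =>
    profile (fun i => x 0 (lshift q i)) (fun j => x 0 (rshift p j))).
Proof.
apply: continuous_big => [|i _]; first exact: add_continuous.
apply: continuous_big => [|j _ x]; first exact: add_continuous.
pose t (y : 'rV[R]_(p + q)) := y 0 (lshift q i) + y 0 (rshift p j).
have ct : {for x, continuous t}.
  by apply: (@continuousD R R^o); exact: coord_continuous.
apply: (@continuousB R R^o _ (fun y => n%:R * t y) (fun y => S i j * expR (t y))).
  by apply: (@continuousM R _ (fun=> n%:R) t); first exact: cst_continuous.
apply: (@continuousM R _ (fun=> S i j) (expR \o t)); first exact: cst_continuous.
by apply: continuous_comp; [exact: ct|exact: continuous_expR].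
Qed.

(* [profile] is invariant under (u, v) |-> (u + c, v - c), so it is coercive
   only after normalizing v to vanish at one index. *)
Lemma profile_has_max : (0 < p)%N -> (0 < q)%N ->
  exists u v, forall u' v', profile u' v' <= profile u v.
Proof.
move=> p_gt0 q_gt0; pose i0 := Ordinal p_gt0; pose j0 := Ordinal q_gt0.
(* By [profile_ub], any point with a larger value than the origin satisfies [|u i + v j| <= C] for
   all [i], [j]. *)
pose C := \sum_i \sum_j (n%:R + 1) ^+ 2 / S i j - profile (fun=> 0) (fun=> 0).
have C0 : 0 <= C.
  rewrite subr_ge0 (le_trans (profile_ub _ _))// gerBl.
  by apply: sumr_ge0 => i _; apply: sumr_ge0.
(* The radius is [2 * C] because the normalized [v j - v j0] is a difference of two sums
   [u i0 + v j] and [u i0 + v j0], each bounded by [C]. *)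
pose box := [set x : 'rV[R]_(p + q) |
  forall k, `[- (2 * C), 2 * C]%classic (x ord0 k)].
have box0 : box 0 by move=> k; rewrite /= mxE in_itv/=; lra.
have cbox : compact box.
  apply: (@rV_compact _ _ (fun=> `[- (2 * C), 2 * C]%classic)) => _.
  exact: segment_compact.
have [|x _ xmax] := EVT_max_rV _ cbox (continuous_subspaceT continuous_profile).
  by exists 0.
exists (fun i => x 0 (lshift q i)), (fun j => x 0 (rshift p j)) => u v.
(* Points not above the origin are dominated by the maximum over the box, which contains the origin;
   all others can be shifted into the box. *)
have [uv0|uv0] := leP (profile u v) (profile (fun=> 0) (fun=> 0)).
  apply: le_trans uv0 _; have := xmax 0; rewrite inE => /(_ box0).
  by congr (_ <= _); apply: eq_bigr => i _; apply: eq_bigr => j _; rewrite !mxE.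
have sumC : \sum_i \sum_j `|u i + v j| <= C.
  by have := profile_ub u v; rewrite /C; lra.
have tC i j : `|u i + v j| <= C.
  apply: le_trans sumC; rewrite (bigD1 i)//= (bigD1 j)//= -addrA lerDl.
  by rewrite addr_ge0// ?sumr_ge0// => k _; apply: sumr_ge0.
pose y : 'rV[R]_(p + q) :=
  row_mx (\row_i (u i + v j0)) (\row_j (v j - v j0)).
rewrite -(profile_shift u v (v j0)).
have -> : profile (fun i => u i + v j0) (fun j => v j - v j0) =
    profile (fun i => y 0 (lshift q i)) (fun j => y 0 (rshift p j)).
  by apply: eq_bigr => i _; apply: eq_bigr => j _; rewrite row_mxEl row_mxEr !mxE.
apply: xmax; rewrite inE => k /=; rewrite in_itv/= -ler_norml.
case: (split_ordP k) => [i|j] ->; rewrite ?row_mxEl ?row_mxEr mxE.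
  by have := tC i j0; lra.
have -> : v j - v j0 = (u i0 + v j) - (u i0 + v j0) by ring.
by rewrite (le_trans (ler_normB _ _))//; have := tC i0 j; have := tC i0 j0; lra.
Qed.

(** Quantitative concavity: the linear parts cancel, and each exponential part is a perfect square,
    [a ^+ 2 + b ^+ 2 - 2 * a * b], in the exponentials of the half sums. *)
Lemma profile_midpoint u v u' v' :
  2 * profile (fun i => (u i + u' i) / 2) (fun j => (v j + v' j) / 2)
    - profile u v - profile u' v' =
  \sum_i \sum_j
    S i j * (expR ((u i + v j) / 2) - expR ((u' i + v' j) / 2)) ^+ 2.
Proof.
rewrite mulr_sumr -!sumrB; apply: eq_bigr => i _.
rewrite mulr_sumr -!sumrB; apply: eq_bigr => j _.
rewrite (expR_half (u i + v j)) (expR_half (u' i + v' j)).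
rewrite (_ : _ / 2 + _ / 2 = (u i + v j) / 2 + (u' i + v' j) / 2); last by field.
by rewrite expRD; field.
Qed.

(** At two maximizers the left side of [profile_midpoint] is at most zero, while the right side is a
    sum of nonnegative terms. So every square vanishes, and [expR] is injective. *)
Lemma profile_max_unique u v u' v' :
  (forall u1 v1, profile u1 v1 <= profile u v) ->
  (forall u1 v1, profile u1 v1 <= profile u' v') ->
  forall i j, u i + v j = u' i + v' j.
Proof.
move=> maxuv maxuv' i j; have := profile_midpoint u v u' v'.
set m := profile _ _ => midE.
have term0 i1 j1 : 0 <= S i1 j1 *
    (expR ((u i1 + v j1) / 2) - expR ((u' i1 + v' j1) / 2)) ^+ 2.
  by rewrite mulr_ge0 ?sqr_ge0// ltW.
have sum0 : \sum_i1 \sum_j1 S i1 j1 *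
    (expR ((u i1 + v j1) / 2) - expR ((u' i1 + v' j1) / 2)) ^+ 2 = 0.
  apply/eqP; rewrite eq_le; apply/andP; split.
    have h : m <= profile u v by exact: maxuv.
    have h' : m <= profile u' v' by exact: maxuv'.
    by rewrite -midE; lra.
  by apply: sumr_ge0 => i1 _; apply: sumr_ge0.
have row0 := @psumr_eq0P _ _ _ _
  (fun i1 _ => sumr_ge0 _ (fun j1 _ => term0 i1 j1)) sum0 i isT.
have /eqP := @psumr_eq0P _ _ _ _ (fun j1 _ => term0 i j1) row0 j isT.
rewrite mulf_eq0 gt_eqF//= sqrf_eq0 subr_eq0 => /eqP/expR_inj; lra.
Qed.

End Profile.

(** * Diagonal matrices with positive entries *)

Lemma invmx_diag (F : fieldType) (m : nat) (e : 'rV[F]_m) :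
  (forall i, e 0 i != 0) -> invmx (diag_mx e) = diag_mx (\row_i (e 0 i)^-1).
Proof.
move=> e0.
have eV : diag_mx e *m diag_mx (\row_i (e 0 i)^-1) = 1%:M.
  apply/matrixP => i j; rewrite mul_diag_mx !mxE.
  by case: eqVneq => [->|_]; rewrite ?mulr0n ?mulr0// !mulr1n divff.
have /mulKmx eK : diag_mx e \in unitmx by case/mulmx1_unit: eV.
by rewrite -[RHS]eK eV mulmx1.
Qed.

Lemma pos_diagP (R : realType) (m : nat) (A : 'M[R]_m) :
  pos_diag A -> A = diag_mx (\row_i A i i).
Proof.
move=> [/is_diag_mxP dA _]; apply/matrixP => i j; rewrite !mxE.
by case: eqVneq => [->|/dA ->].
Qed.

Lemma pos_diag_expR (R : realType) (m : nat) (u : 'I_m -> R) :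
  pos_diag (diag_mx (\row_i expR (u i))).
Proof.
by split=> [|i]; [exact: diag_mx_is_diag|rewrite !mxE eqxx mulr1n expR_gt0].
Qed.

Lemma det_pos_diag (R : realType) (m : nat) (A : 'M[R]_m) :
  pos_diag A -> \det A = expR (\sum_i ln (A i i)).
Proof.
move=> dA; rewrite {1}(pos_diagP dA) det_diag expR_sum.
by apply: eq_bigr => i _; rewrite mxE lnK// posrE; case: dA.
Qed.

Lemma eq_tensmx_pos_diag (R : realType) (p q : nat) (A A' : 'M[R]_q)
    (B B' : 'M[R]_p) :
  pos_diag A -> pos_diag A' -> pos_diag B -> pos_diag B' ->
  (forall i j, A j j * B i i = A' j j * B' i i) ->
  tensmx A B = tensmx A' B'.
Proof.
move=> [/is_diag_mxP dA _] [/is_diag_mxP dA' _] [/is_diag_mxP dB _]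
  [/is_diag_mxP dB' _] eqAB.
apply/matrixP => k l; case: (mxtens_indexP k) => j i.
case: (mxtens_indexP l) => j' i'; rewrite !tensmxE.
have [->|jj] := eqVneq j j'; last by rewrite dA// dA'// !mul0r.
by have [->|ii] := eqVneq i i'; rewrite ?eqAB// dB// dB'// !mulr0.
Qed.

(** * Reduction of the likelihood to the profile function *)

Section Estimation.
Variables (R : realType) (p q n : nat) (X : 'I_n -> 'M[R]_(p, q)).
Hypothesis n_gt0 : (0 < n)%N.

Definition sq_dev (M : 'M[R]_(p, q)) (i : 'I_p) (j : 'I_q) : R :=
  \sum_k (X k i j - M i j) ^+ 2.

(** The two sides differ by [n%:R * (a - b) ^+ 2], with [a] and [b] the entries of the sample mean
    and of [M]. *)
Lemma sq_dev_sample_mean M i j : sq_dev (sample_mean X) i j <= sq_dev M i j.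
Proof.
set a := sample_mean X i j; set b := M i j.
have sumX : \sum_k X k i j = n%:R * a.
  by rewrite /a /sample_mean mxE summxE mulrA divff ?mul1r// pnatr_eq0 -lt0n.
rewrite /sq_dev -subr_ge0 -sumrB.
rewrite (eq_bigr (fun k => 2 * (a - b) * X k i j + (b ^+ 2 - a ^+ 2))).
  rewrite big_split/= -mulr_sumr sumX sumr_const card_ord -[(_ - _) *+ n]mulr_natl.
  rewrite (_ : _ + _ = n%:R * (a - b) ^+ 2); last by ring.
  by rewrite mulr_ge0 ?sqr_ge0.
by move=> k _; rewrite -/a -/b; ring.
Qed.

(** A vanishing sum of squares would force all samples to share the entry [M i j]. *)
Lemma sq_dev_gt0 M i j k l : X k i j != X l i j -> 0 < sq_dev M i j.
Proof.
move=> kl; rewrite lt0r sumr_ge0 ?andbT => [|m _]; last exact: sqr_ge0.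
apply: contra_neq kl => /psumr_eq0P sq0.
have Xm m : X m i j = M i j.
  by apply/eqP; rewrite -subr_eq0 -sqrf_eq0 sq0// => ? _; exact: sqr_ge0.
by rewrite !Xm.
Qed.

(** The determinant powers give the linear part of [profile]; the trace, expanded entrywise, gives
    the exponential part. *)
Lemma likelihood_profile M (Gamma : 'M[R]_p) (Psi : 'M[R]_q) :
  pos_diag Gamma -> pos_diag Psi ->
  likelihood X M Gamma Psi =
  (2 * pi) `^ (- (p * q * n)%:R / 2) *
  expR (2^-1 * profile n (sq_dev M) (fun i => - ln (Gamma i i))
                                    (fun j => - ln (Psi j j))).
Proof.
move=> dG dP; have [_ G0] := dG; have [_ P0] := dP.
rewrite /likelihood !det_pos_diag// -!expRM -!mulrA -!expRD; congr (_ * expR _).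
have -> : invmx Gamma = diag_mx (\row_i (Gamma i i)^-1).
  rewrite {1}(pos_diagP dG) invmx_diag => [|i]; last by rewrite mxE gt_eqF.
  by congr diag_mx; apply/rowP => i; rewrite !mxE.
have -> : invmx Psi = diag_mx (\row_j (Psi j j)^-1).
  rewrite {1}(pos_diagP dP) invmx_diag => [|j]; last by rewrite mxE gt_eqF.
  by congr diag_mx; apply/rowP => j; rewrite !mxE.
have -> : \tr (diag_mx (\row_j (Psi j j)^-1) *m \sum_k
      ((X k - M)^T *m diag_mx (\row_i (Gamma i i)^-1) *m (X k - M))) =
    \sum_i \sum_j sq_dev M i j * expR (- ln (Gamma i i) - ln (Psi j j)).
  rewrite [RHS]exchange_big/=; apply: eq_bigr => j _.
  rewrite mul_diag_mx !mxE summxE mulr_sumr.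
  under [LHS]eq_bigr do rewrite mul_mx_diag mxE mulr_sumr.
  rewrite exchange_big/=; apply: eq_bigr => i _.
  rewrite /sq_dev mulr_suml; apply: eq_bigr => k _.
  by rewrite !mxE expRD !expRN !lnK ?posrE//; ring.
rewrite /profile.
under [in RHS]eq_bigr do rewrite sumrB.
rewrite sumrB mulrBr [- 2^-1 * _]mulNr addrA; congr (_ - _).
have -> : \sum_i \sum_j n%:R * (- ln (Gamma i i) - ln (Psi j j)) =
    - (n%:R * (q%:R * (\sum_i ln (Gamma i i)) + p%:R * \sum_j ln (Psi j j))).
  under eq_bigr do rewrite -mulr_sumr sumrB sumr_const card_ord.
  rewrite -mulr_sumr sumrB sumr_const card_ord sumrMnl sumrN.
  by rewrite -[(- _) *+ q]mulr_natl -[(\sum_j _) *+ p]mulr_natl; ring.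
by rewrite !natrM; field.
Qed.

Lemma diag_MLE_exists_unique : (0 < p)%N -> (0 < q)%N ->
  (forall i j, 0 < sq_dev (sample_mean X) i j) ->
  exists! K, is_diag_MLE X K.
Proof.
move=> p_gt0 q_gt0 S0; pose S := sq_dev (sample_mean X).
have c0 : 0 < (2 * pi : R) `^ (- (p * q * n)%:R / 2).
  by rewrite powR_gt0// mulr_gt0// pi_gt0.
have [u [v uvmax]] := profile_has_max n_gt0 S0 p_gt0 q_gt0.
pose Gamma : 'M[R]_p := diag_mx (\row_i expR (- u i)).
pose Psi : 'M[R]_q := diag_mx (\row_j expR (- v j)).
have dG : pos_diag Gamma := pos_diag_expR _.
have dP : pos_diag Psi := pos_diag_expR _.
have lnG i : ln (Gamma i i) = - u i by rewrite !mxE eqxx mulr1n expRK.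
have lnP j : ln (Psi j j) = - v j by rewrite !mxE eqxx mulr1n expRK.
exists (tensmx Psi Gamma); split.
  exists Gamma, Psi; split => // M G P dG1 dP1.
  rewrite !likelihood_profile// ler_pM2l// ler_expR ler_pM2l ?invr_gt0//.
  apply: (@le_trans _ _ (profile n S (fun i => - ln (G i i))
                                     (fun j => - ln (P j j)))).
    (* Replacing [M] by the sample mean decreases every coefficient of an exponential. *)
    apply: ler_sum => i _; apply: ler_sum => j _.
    by rewrite lerD2l lerN2 ler_pM2r ?expR_gt0// sq_dev_sample_mean.
  apply: le_trans (uvmax _ _) _; rewrite le_eqVlt; apply/orP; left; apply/eqP.
  by congr (profile n S); apply/funext => ?; rewrite ?lnG ?lnP opprK.
move=> _ [G [P [dG1 dP1 -> GPmax]]].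
(* Comparing the other estimator with the diagonal matrices of entries [expR (- u1 i)] and
   [expR (- v1 j)] shows that its negated logarithms also maximize [profile]. *)
have GPmax' u1 v1 :
    profile n S u1 v1 <=
    profile n S (fun i => - ln (G i i)) (fun j => - ln (P j j)).
  have := GPmax (sample_mean X) _ _ (pos_diag_expR (fun i => - u1 i))
    (pos_diag_expR (fun j => - v1 j)).
  rewrite !likelihood_profile//; try exact: pos_diag_expR.
  rewrite ler_pM2l// ler_expR ler_pM2l ?invr_gt0//; apply: le_trans.
  rewrite le_eqVlt; apply/orP; left; apply/eqP.
  by congr (profile n S); apply/funext => ?; rewrite !mxE eqxx mulr1n expRK opprK.
have uvE := profile_max_unique S0 uvmax GPmax'.
apply: eq_tensmx_pos_diag => // i j.
have [_ G0] := dG1; have [_ P0] := dP1.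
rewrite -[P j j]lnK ?posrE// -[G i i]lnK ?posrE// !mxE !eqxx !mulr1n -!expRD.
by congr expR; have := uvE i j; lra.
Qed.

End Estimation.

(** * The almost sure conclusion *)

Unset Implicit Arguments.
Set Strict Implicit.

Theorem theorem6 (R : realType) (d : measure_display) (T : measurableType d)
    (P : probability T R) (p q n : nat)
    (p_gt0 : (0 < p)%N) (q_gt0 : (0 < q)%N) (n_ge2 : (2 <= n)%N)
    (mu : 'cV[R]_(q * p)) (Gamma : 'M[R]_p) (Psi : 'M[R]_q)
    (GammaP : pos_diag Gamma) (PsiP : pos_diag Psi)
    (X : 'I_n -> {RV P >-> borel_mx R p q})
    (X_indep : independent_RVs X)
    (X_normal : forall k : 'I_n,
       multivariate_normal P (fun w => vec (X k w)) mu (tensmx Psi Gamma)) :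
  {ae P, forall w, exists! K : 'M[R]_(q * p), is_diag_MLE (fun k => X k w) K}.
Proof.
(* The indices 0 and 1, distinct samples available because [n >= 2]. *)
pose k : 'I_n := Ordinal (ltnW n_ge2); pose l : 'I_n := Ordinal n_ge2.
have neq i j : {ae P, forall w, X k w i j != X l w i j}.
  exact: (normal_entries_ae_neq i j GammaP PsiP X_indep (X_normal l)).
have : {ae P, forall w i j, X k w i j != X l w i j}.
  (* Only finitely many pairs [(i, j)] occur, so the almost sure events can be intersected. *)
  by apply: filter_forall => i; apply: filter_forall => j; exact: neq.
apply: filterS => w Xkl.
apply: diag_MLE_exists_unique => // [|i j]; first exact: ltnW.
exact: (sq_dev_gt0 _ (Xkl i j)).
Qed.
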